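(* Let $(g_n)_{n\ge 0}$ be the sequence defined by $g_0=1$ and, for $n\ge 1$, $g_n$ is the $n$th prime number (so $g_1=2$, $g_2=3$, $g_3=5$, and so on). Then $(g_n)_{n\ge 0}$ is not holonomic.
   Context: A sequence $(f_n)_{n\ge0}$ of complex numbers is called holonomic (or $P$-recursive) if there exist an integer $d\ge 0$ and polynomials $p_0,\dots,p_d\in\mathbb{C}[X]$, not all zero, such that $p_0(n)f_{n+d}+p_1(n)f_{n+d-1}+\cdots+p_d(n)f_n=0$ for all integers $n\ge 0$. *)

(* Defs.v *)
From mathcomp Require Import all_boot all_order all_algebra.
From mathcomp Require Import reals complex.

Set Implicit Arguments.
Unset Strict Implicit.
Unset Printing Implicit Defensive.

Import GRing.Theory.

Local Open Scope ring_scope.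

Definition holonomic (R : realType) (f : nat -> R[i]) : Prop :=
  exists (d : nat) (p : 'I_d.+1 -> {poly R[i]}),
    (exists i : 'I_d.+1, p i != 0) /\
    (forall n : nat, \sum_(i < d.+1) (p i).[n%:R] * f (n + (d - i))%N = 0).

Local Open Scope nat_scope.

Lemma ex_prime_gt (m : nat) : exists p, (m < p) && prime p.
Proof. by have [p lt_mp pr_p] := prime_above m; exists p; rewrite lt_mp. Qed.

Definition next_prime (m : nat) : nat := ex_minn (ex_prime_gt m).

(* Indexed from 0: nth_prime 0 = 2, nth_prime 1 = 3, nth_prime 2 = 5. *)
Fixpoint nth_prime (k : nat) : nat :=
  if k is k'.+1 then next_prime (nth_prime k') else 2.

Definition prime_seq (n : nat) : nat :=
  if n is k.+1 then nth_prime k else 1.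

Lemma next_primeP (m : nat) :
  [/\ m < next_prime m, prime (next_prime m)
    & forall q, prime q -> m < q -> next_prime m <= q].
Proof.
rewrite /next_prime; case: ex_minnP => p /andP[lt_mp pr_p] min_p.
by split=> // q pr_q lt_mq; apply: min_p; rewrite lt_mq.
Qed.

Lemma prime_nth_prime (k : nat) : prime (nth_prime k).
Proof. by case: k => [|k] //=; case: (next_primeP (nth_prime k)). Qed.

(* There are exactly k + 1 primes up to the prime nth_prime k. *)
Lemma count_nth_prime (k : nat) :
  count prime (iota 0 (nth_prime k).+1) = k.+1.
Proof.
elim: k => [|k IHk] //=.
have [lt_p pr_p min_p] := next_primeP (nth_prime k).
set p := nth_prime k in lt_p pr_p min_p IHk *.
set q := next_prime p in lt_p pr_p min_p *.
rewrite -[count _ (iota 1 q)]/(count prime (iota 0 q.+1)).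
rewrite -addn1 iotaD count_cat /= add0n pr_p addn0 -(subnKC lt_p) iotaD.
rewrite count_cat IHk add0n (_ : count _ (iota p.+1 _) = 0) ?addn0 ?addn1 //.
apply/eqP; rewrite -leqn0 leqNgt -has_count; apply/hasPn => r.
rewrite mem_iota subnKC // => /andP[lt_pr lt_rq]; apply/negP => pr_r.
by have := min_p r pr_r lt_pr; rewrite leqNgt lt_rq.
Qed.

(* Main.v *)
Require Import Defs.
From mathcomp Require Import all_boot all_order all_algebra.
From mathcomp Require Import reals complex.
From mathcomp Require Import boolp.
From mathcomp Require Import zify ring.

(* Rational linear dependence makes the coefficients rational, and dividing by
   the largest power of n shows that the prime gaps satisfy, up to an error
   O(gaps / n + g_n / n^2), a recurrence with constant integer coefficients. The
   combination of gaps is an integer, so wherever gaps are o(n) the recurrence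
   is exact. Since g_n = O(n log n) for arbitrarily large n, there are stretches
   of polylogarithmic length with this property and average gap O(log n);
   pigeonhole then gives two equal short windows of gaps, close together, and
   the recurrence makes the gaps periodic on the rest of the stretch. Hence the
   primes contain a progression x + j Q with all j <= Q and Q + 1 < x, but one
   of these terms is divisible by Q + 1. *)

Set Implicit Arguments.
Unset Strict Implicit.
Unset Printing Implicit Defensive.

Import Order.TTheory GRing.Theory Num.Theory.

Local Open Scope ring_scope.

(** * From complex to rational coefficients *)

(** Think of [q] as the image of [c] under a nonzero rational linear form on the span of the [c i].
    The induction removes one index for each rational relation among them. *)
Lemma rational_relations (F : numFieldType) (I : finType) (A : {set I})
    (c : I -> F) :
  (exists2 i, i \in A & c i != 0) ->
  exists2 q : I -> rat, (exists2 i, i \in A & q i != 0) &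
    forall v : I -> rat, \sum_(i in A) c i * ratr (v i) = 0 ->
      \sum_(i in A) q i * v i = 0.
Proof.
elim: {A}_.+1 {-2}A (ltnSn #|A|) => // n IHn A leAn [i0 Ai0 ci0].
have [[v [cv0 [j Aj vj]]]|free] := pselect (exists v : I -> rat,
  \sum_(i in A) c i * ratr (v i) = 0 /\ exists2 j, j \in A & v j != 0); last first.
  (* Here the [c i] are independent over the rationals: only [v] vanishing on [A] qualifies, so any
     nonzero [q] works. *)
  exists (fun=> 1) => [|v cv0]; first by exists i0; rewrite ?oner_eq0.
  rewrite big1 // => i Ai; rewrite mul1r; apply/eqP/negPn/negP => vi.
  by apply: free; exists v; split=> //; exists i.
have inA k : (k \in A :\ j) = (k \in A) && (k != j) by rewrite !inE andbC.
have ltAn : (#|A :\ j| < n)%N by move: leAn; rewrite (cardsD1 j A) Aj ltnS.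
have vjF : ratr (v j) != 0 :> F by rewrite fmorph_eq0.
have [|q [i Ai qi] qP] := IHn (A :\ j) ltAn.
  apply/exists_inP; apply: contraT; rewrite negb_exists_in => /forall_inP c0.
  have {}c0 i : i \in A -> i != j -> c i = 0.
    by move=> Ai ij; apply/eqP/negPn; apply: c0; rewrite inA Ai.
  move: cv0; rewrite (bigD1 j) //= big1 ?addr0 => [/eqP|i /andP[Ai ij]]; last first.
    by rewrite c0 // mul0r.
  rewrite mulf_eq0 (negPf vjF) orbF => /eqP cj0.
  have [/eqP ij|ij] := boolP (i0 == j); first by rewrite ij cj0 eqxx in ci0.
  by rewrite c0 ?eqxx in ci0.
(* The value at [j] makes [q] orthogonal to [v]; any [w] can then be cleared at [j] by subtracting a
   multiple of [v]. *)
exists (fun k => if k == j then - (\sum_(i in A :\ j) q i * v i) / v j else q k).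
  by move: Ai; rewrite inA => /andP[Ai ij]; exists i => //; rewrite (negPf ij).
move=> w cw0; rewrite (bigD1 j) //= eqxx.
rewrite [X in _ + X = _](_ : _ = \sum_(i in A :\ j) q i * w i); last first.
  by apply: eq_big => [k|k /andP[_ /negPf->]] //; rewrite inA.
have /qP : \sum_(i in A :\ j) c i * ratr (w i - w j / v j * v i) = 0.
  transitivity (\sum_(i in A) c i * ratr (w i - w j / v j * v i)).
    rewrite [RHS](bigD1 j) //= divfK // subrr rmorph0 mulr0 add0r.
    by apply: eq_bigl => k; rewrite inA.
  transitivity (\sum_(i in A) c i * ratr (w i) -
      ratr (w j / v j) * \sum_(i in A) c i * ratr (v i)); last first.
    by rewrite cw0 cv0 mulr0 subr0.
  rewrite mulr_sumr -sumrB; apply: eq_bigr => k _.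
  by rewrite rmorphB rmorphM /=; ring.
have -> : \sum_(i in A :\ j) q i * (w i - w j / v j * v i) =
    \sum_(i in A :\ j) q i * w i - w j / v j * \sum_(i in A :\ j) q i * v i.
  by rewrite mulr_sumr -sumrB; apply: eq_bigr => k _; ring.
by move=> sum0; rewrite -[RHS]sum0; ring.
Qed.

(** The recurrences are linear relations among the coefficients of the [p i], with integer weights
    [n ^ j * f (n + i)]; a single [q] serves all [n]. *)
Lemma rational_recurrence (F : numFieldType) (d : nat)
    (p : 'I_d.+1 -> {poly F}) (f : nat -> nat) :
  (exists i, p i != 0) ->
  (forall n, \sum_(i < d.+1) (p i).[n%:R] * (f (n + i)%N)%:R = 0) ->
  exists2 q : 'I_d.+1 -> {poly rat}, (exists i, q i != 0) &
    forall n, \sum_(i < d.+1) (q i).[n%:R] * (f (n + i)%N)%:R = 0.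
Proof.
move=> [i0 pi0] pf0; pose D := \max_i size (p i).
have szp i : (size (p i) <= D)%N by exact: leq_bigmax.
pose c (ij : 'I_d.+1 * 'I_D) := (p ij.1)`_ij.2.
have lt_D : ((size (p i0)).-1 < D)%N.
  by rewrite prednK ?size_poly_gt0 //.
have [|q [[i j] _ qij] qP] := @rational_relations F _ setT c.
  by exists (i0, Ordinal lt_D); rewrite ?inE // /c /= -lead_coefE lead_coef_eq0.
exists (fun i => \poly_(k < D) (if insub k is Some k' then q (i, k') else 0)).
  exists i; apply: contraNneq qij => /polyP/(_ j).
  by rewrite coef_poly ltn_ord coef0 valK => ->.
move=> n; have /qP : \sum_(ij in setT) c ij * ratr (n ^ ij.2 * f (n + ij.1))%N%:R = 0.
  rewrite (eq_bigl xpredT) => [|?]; last by rewrite inE.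
  rewrite -(pair_bigA _ (fun i j => c (i, j) * ratr (n ^ j * f (n + i))%N%:R)) /=.
  rewrite -[RHS](pf0 n); apply: eq_bigr => k _.
  rewrite (horner_coef_wide _ (szp k)) mulr_suml; apply: eq_bigr => l _.
  by rewrite ratr_nat natrM natrX mulrA.
rewrite /= (eq_bigl xpredT) => [|?]; last by rewrite inE.
move=> sum0; transitivity (\sum_(i < d.+1) \sum_(j < D)
    q (i, j) * (n ^ j * f (n + i))%N%:R); last first.
  by rewrite pair_bigA -[RHS]sum0; apply: eq_bigr => -[].
apply: eq_bigr => k _.
rewrite horner_poly mulr_suml; apply: eq_bigr => l _.
by rewrite valK natrM natrX mulrA.
Qed.

Local Open Scope nat_scope.

(** * A Chebyshev-type upper bound for the primes *)

(** By Legendre's formula the exponent counts the carries in adding [m] and [n - m] in base [p], at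
    most one for each [p ^ i <= n] with [0 < i]. *)
Lemma logn_bin_le (p n m : nat) : prime p -> m <= n ->
  logn p 'C(n, m) <= trunc_log p n.
Proof.
move=> p_pr lemn; have p_gt1 := prime_gt1 p_pr.
have fact_sum k : k <= n -> logn p k`! = \sum_(1 <= i < n.+1) k %/ p ^ i.
  move=> lekn; rewrite logn_fact // [RHS](big_cat_nat (n := k.+1)) //=.
  rewrite [X in _ = _ + X]big_nat [X in _ = _ + X]big1 ?addn0 // => i /andP[ltki _].
  by rewrite divn_small // (leq_trans ltki) // ltnW // ltn_expl.
have : logn p n`! = logn p 'C(n, m) + (logn p m`! + logn p (n - m)`!).
  by rewrite -(bin_fact lemn) !lognM ?muln_gt0 ?fact_gt0 ?bin_gt0 ?lemn.
rewrite !fact_sum ?leq_subr // -big_split /= => logE.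
rewrite -(leq_add2r (\sum_(1 <= i < n.+1) (m %/ p ^ i + (n - m) %/ p ^ i))) -logE.
have -> : trunc_log p n = \sum_(1 <= i < n.+1) (i <= trunc_log p n).
  have le_t : trunc_log p n <= n.
    have [->|n_gt0] := posnP n; first by rewrite trunc_log0.
    by rewrite (leq_trans (ltnW (ltn_expl _ p_gt1))) ?trunc_logP.
  rewrite (big_cat_nat (n := (trunc_log p n).+1)) //=.
  rewrite [X in _ + X]big_nat [X in _ + X]big1 ?addn0 => [|i /andP[lti _]]; last first.
    by rewrite leqNgt lti.
  rewrite big_nat (eq_bigr (fun=> 1)) => [|i /andP[_]]; last first.
    by rewrite ltnS => ->.
  by rewrite -big_nat sum_nat_const_nat subn1 muln1.
rewrite -big_split /=; apply: leq_sum => i _.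
have pi_gt0 : 0 < p ^ i by rewrite expn_gt0 ltnW.
have [le_i|lt_i] := leqP i (trunc_log p n); last first.
  rewrite divn_small // (leq_trans (trunc_log_ltn n p_gt1)) //.
  by rewrite leq_pexp2l // ltnW.
rewrite -{1}(subnKC lemn) divnD // addnC leq_add2r.
exact: leq_b1.
Qed.

(** Only primes up to [n] divide the binomial coefficient, and each contributes a power that is at
    most [n]. *)
Lemma leq_bin_exp_primes (n m : nat) : m <= n ->
  'C(n, m) <= n ^ count prime (iota 0 n.+1).
Proof.
move=> lemn; have [->|n_gt0] := posnP n; first by case: m {lemn}.
have C_gt0 : 0 < 'C(n, m) by rewrite bin_gt0.
rewrite {1}(prod_prime_decomp C_gt0) prime_decompE big_map /=.
apply: (@leq_trans (\prod_(p <- primes 'C(n, m)) n)).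
  rewrite !big_seq; apply: leq_prod => p.
  rewrite mem_primes => /andP[p_pr _].
  have p_gt1 := prime_gt1 p_pr.
  apply: leq_trans (trunc_logP p_gt1 n_gt0).
  by rewrite leq_pexp2l ?prime_gt0 ?logn_bin_le.
rewrite big_const_seq count_predT iter_muln_1 leq_pexp2l // -size_filter.
apply: uniq_leq_size; first exact: primes_uniq.
move=> p p_in; have p_pr : prime p by move: p_in; rewrite mem_primes => /andP[].
rewrite mem_filter mem_iota p_pr prime_gt0 //; have [//|lt_np] := leqP p n.
have t0 : trunc_log p n = 0.
  by apply/eqP; rewrite trunc_log_eq0; have := prime_gt0 p_pr; lia.
by have := logn_bin_le p_pr lemn; rewrite t0 leqNgt logn_gt0 p_in.
Qed.

Lemma exp2_le_central_bin (n : nat) : 2 ^ n <= 'C(n.*2, n).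
Proof.
elim: n => // n IHn; rewrite expnS mul2n -addnn doubleS !binS.
apply: leq_add; apply: leq_trans IHn _.
  exact: leq_addl.
by case: n => [|n]; rewrite ?bin0 // [leqRHS]binS leq_addr.
Qed.

(** Otherwise fewer than [k] primes are at most [2 ^ r.+1], too few for a central binomial
    coefficient that is at least [2 ^ (2 ^ r)]. *)
Lemma prime_seq_le (r k : nat) : k * r.+1 <= 2 ^ r -> prime_seq k <= 2 ^ r.+1.
Proof.
case: k => [|k] /= le_kr; first by rewrite expn_gt0.
rewrite leqNgt; apply/negP => lt_p.
have le_count : count prime (iota 0 (2 ^ r.+1).+1) <= k.
  rewrite -ltnS -(count_nth_prime k) -[in X in _ < X](subnKC lt_p) -addnS.
  rewrite iotaD count_cat -[ltnLHS]addn0 ltn_add2l add0n -has_count.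
  apply/hasP; exists (nth_prime k); last exact: prime_nth_prime.
  by rewrite mem_iota lt_p addnS subnKC //=.
have : 2 ^ (2 ^ r) <= (2 ^ r.+1) ^ k.
  apply: leq_trans (exp2_le_central_bin _) _.
  rewrite -mul2n -expnS; apply: leq_trans (leq_bin_exp_primes _) _.
    by rewrite leq_pexp2l.
  by rewrite leq_pexp2l ?expn_gt0.
rewrite -expnM leq_exp2l // => le_r.
by move: (leq_trans le_kr le_r); rewrite mulnC leq_pmul2l // ltnn.
Qed.

Lemma ltn_prime_seq (n : nat) : prime_seq n < prime_seq n.+1.
Proof.
case: n => // n.
by rewrite /=; case: (next_primeP (nth_prime n)).
Qed.

Lemma exp2_dominates (A e : nat) : exists r, A * r.+1 ^ e <= 2 ^ r.
Proof.
(* Now [r.+1 = 2 ^ (2 * q)], and the left side is at most 2 to the power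
   [A + 2 * q * e < q.+1 ^ 2 <= r.+1]. *)
pose q := A + 2 * e + 2; exists (2 ^ q * 2 ^ q - 1).
have q2 : q.+1 <= 2 ^ q by exact: ltn_expl.
rewrite subn1 prednK ?muln_gt0 ?expn_gt0 // -expnD -expnM.
have A2 : A <= 2 ^ A by rewrite ltnW // ltn_expl.
apply: leq_trans (_ : 2 ^ (A + (q + q) * e) <= _).
  by rewrite [leqRHS]expnD leq_mul2r A2 orbT.
rewrite leq_exp2l // -ltnS prednK ?expn_gt0 //.
by rewrite expnD; apply: leq_trans (leq_mul q2 q2); rewrite /q; nia.
Qed.

Local Open Scope ring_scope.

(** * A constant-coefficient relation between gaps *)

Definition gap (f : nat -> nat) (n : nat) : int := (f n.+1)%:Z - (f n)%:Z.

(** Comparing the points [1 / n.+1], [1 / n] and [0], this yields coefficient errors [O(1 / n)] and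
    [O(1 / n ^ 2)]. *)
Lemma poly_lipschitz01 (F : realFieldType) (p : {poly F}) :
  exists2 C, 0 <= C & forall x y, 0 <= x <= 1 -> 0 <= y <= 1 ->
    `|p.[x] - p.[y]| <= C * `|x - y|.
Proof.
elim/poly_ind: p => [|p c [C C_ge0 pC]].
  by exists 0 => // x y _ _; rewrite !horner0 subrr normr0 mul0r.
exists (`|p.[0]| + C + C) => [|x y x01 y01]; first by rewrite !addr_ge0.
rewrite !hornerMXaddC.
have -> : p.[x] * x + c - (p.[y] * y + c) =
    (p.[0] + (p.[x] - p.[0])) * (x - y) + (p.[x] - p.[y]) * y by ring.
have le_p : `|p.[x] - p.[0]| <= C.
  apply: le_trans (pC x 0 x01 _) _; first by rewrite lexx ler01.
  move: x01 => /andP[x0 x1]; rewrite subr0 ger0_norm //.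
  by rewrite ler_piMr.
apply: le_trans (ler_normD _ _) _; rewrite !normrM mulrDl.
apply: lerD.
  apply: ler_wpM2r => //; apply: le_trans (ler_normD _ _) _.
  by rewrite lerD2l.
move: y01 => /[dup] y01 /andP[y0 y1]; rewrite (ger0_norm y0).
by apply: le_trans (pC x y x01 y01); rewrite ler_piMr.
Qed.

Lemma horner_rev (F : fieldType) (D : nat) (q : {poly F}) (x : F) :
  (size q <= D.+1)%N -> x != 0 ->
  q.[x] = x ^+ D * (\poly_(i < D.+1) q`_(D - i)).[x^-1].
Proof.
move=> szq x0; rewrite (horner_coef_wide _ szq) horner_poly mulr_sumr.
rewrite (reindex_inj rev_ord_inj) /=; apply: eq_bigr => i _.
have le_i : (i <= D)%N by rewrite -ltnS.
rewrite subSS mulrCA. congr (_ * _).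
by rewrite exprVn expfB_cond // (negPf x0).
Qed.

(* Dividing the recurrence by [n ^ D], with [D] the largest degree, turns its
   coefficients into polynomials in [1 / n]. Subtracting consecutive instances
   then leaves the leading coefficients [a] applied to the gaps. *)
Lemma gap_relation (d : nat) (q : 'I_d.+1 -> {poly rat}) (f : nat -> nat) :
  {homo f : i j / (i <= j)%N} ->
  (exists i, q i != 0) ->
  (forall n, \sum_(i < d.+1) (q i).[n%:R] * (f (n + i)%N)%:R = 0) ->
  exists C (a : 'I_d.+1 -> int), (exists i, a i != 0) /\ forall n, (0 < n)%N ->
    (C * (n * (f (n + d).+1 - f n) + f (n + d)) < n ^ 2)%N ->
    \sum_(i < d.+1) a i * gap f (n + i) = 0.
Proof.
move=> f_homo [i0 qi0] qf0.
pose D := (\max_i size (q i)).-1.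
have szq i : (size (q i) <= D.+1)%N.
  exact: leq_trans (leq_bigmax i) (leqSpred _).
pose U i := \poly_(j < D.+1) (q i)`_(D - j).
have Uf0 n : (0 < n)%N -> \sum_(i < d.+1) (U i).[n%:R^-1] * (f (n + i)%N)%:R = 0.
  move=> n_gt0; have nR : n%:R != 0 :> rat by rewrite pnatr_eq0 -lt0n.
  apply: (mulfI (expf_neq0 D nR)); rewrite mulr0 -[RHS](qf0 n) mulr_sumr.
  by apply: eq_bigr => i _; rewrite (horner_rev (szq i) nR) mulrA.
(* For [q j] of largest degree, the constant term of [U j] is the leading coefficient of [q j]. *)
have [j Uj] : exists j, (U j).[0] != 0.
  have [j Ej] : {j | \max_i size (q i) = size (q j)}.
    by apply: (bigop.eq_bigmax (fun i => size (q i))); rewrite card_ord.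
  have qj : q j != 0.
    rewrite -size_poly_gt0 -Ej; apply: leq_trans (leq_bigmax i0).
    by rewrite size_poly_gt0.
  by exists j; rewrite horner_coef0 coef_poly /= subn0 /D Ej -lead_coefE lead_coef_eq0.
(* [M] clears denominators: [a i = M * u i] is an integer. *)
pose u i := (U i).[0]; pose M := \prod_i denq (u i).
have M_gt0 : (0 : rat) < M%:~R by rewrite ltr0z prodr_gt0 // => i _; apply: denq_gt0.
pose a i := numq (u i) * \prod_(k | k != i) denq (u k).
have aE i : (a i)%:~R = M%:~R * u i :> rat.
  by rewrite /M (bigD1 i) //= !intrM numqE; ring.
have /fin_all_exists2 [L L_ge0 LP] : forall i, exists2 l : rat, 0 <= l &
    forall x y, 0 <= x <= 1 -> 0 <= y <= 1 ->
      `|(U i).[x] - (U i).[y]| <= l * `|x - y|.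
  by move=> i; apply: poly_lipschitz01.
pose B := M%:~R * \sum_i L i.
have B_ge0 : 0 <= B by rewrite mulr_ge0 ?(ltW M_gt0) // sumr_ge0.
exists (Num.bound B), a; split.
  by exists j; rewrite -(intr_eq0 rat) aE mulf_neq0 // lt0r_neq0.
move=> n n_gt0; set V := (f (n + d).+1 - f n)%N; set X := f (n + d)%N => small.
pose x : rat := n%:R^-1; pose y : rat := n.+1%:R^-1.
have n0 : 0 < n%:R :> rat by rewrite ltr0n.
have x0 : 0 < x by rewrite invr_gt0.
have y0 : 0 < y by rewrite invr_gt0 ltr0n.
have x1 : x <= 1 by rewrite invf_le1 // ler1n.
have yx : y <= x by rewrite lef_pV2 ?posrE ?ltr0n // ler_nat.
have xy : x - y <= x ^+ 2.
  have -> : x - y = x * y.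
    by rewrite /x /y -natr1; field; rewrite natr1 !pnatr_eq0 -!lt0n n_gt0.
  by rewrite expr2 ler_pM2l.
have gapE i : (gap f (n + i))%:~R = (f (n.+1 + i)%N)%:R - (f (n + i)%N)%:R :> rat.
  by rewrite /gap intrB addSn.
have gap0 (i : 'I_d.+1) : 0 <= (gap f (n + i))%:~R :> rat.
  by rewrite gapE subr_ge0 ler_nat f_homo // leq_add2r.
have gapV (i : 'I_d.+1) : (gap f (n + i))%:~R <= V%:R :> rat.
  rewrite gapE /V natrB ?f_homo //; last by rewrite -addnS leq_addr.
  by apply: lerB; rewrite ler_nat f_homo ?leq_addr // addSn ltnS leq_add2l -ltnS.
have fX (i : 'I_d.+1) : (f (n + i)%N)%:R <= X%:R :> rat.
  by rewrite ler_nat f_homo // leq_add2l -ltnS.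
(* Subtract the instances at [n] and [n.+1], then replace [U i] at [y] by its constant term
   [u i]. *)
have uE : \sum_(i < d.+1) u i * (gap f (n + i))%:~R =
    - \sum_(i < d.+1) (((U i).[y] - u i) * (gap f (n + i))%:~R +
                        ((U i).[y] - (U i).[x]) * (f (n + i)%N)%:R).
  have := Uf0 n.+1 (ltn0Sn n); have := Uf0 n n_gt0; rewrite -/x -/y => Ux Uy.
  apply/eqP; rewrite -addr_eq0 -big_split /=.
  rewrite (eq_bigr (fun i : 'I_d.+1 => (U i).[y] * (f (n.+1 + i)%N)%:R -
      (U i).[x] * (f (n + i)%N)%:R)) => [|i _]; last by rewrite gapE; ring.
  by rewrite sumrB Ux Uy subrr.
have : `|\sum_(i < d.+1) u i * (gap f (n + i))%:~R| <=
    \sum_(i < d.+1) L i * (x * V%:R + x ^+ 2 * X%:R).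
  rewrite uE normrN; apply: le_trans (ler_norm_sum _ _ _) _.
  apply: ler_sum => i _; apply: le_trans (ler_normD _ _) _.
  rewrite !normrM (ger0_norm (gap0 i)) normr_nat mulrDr !mulrA; apply: lerD.
    apply: ler_pM => //; apply: le_trans (LP i y 0 _ _) _.
    - by rewrite (ltW y0) (le_trans yx).
    - by rewrite lexx ler01.
    - by rewrite subr0 gtr0_norm // ler_wpM2l.
  apply: ler_pM => //; apply: le_trans (LP i y x _ _) _.
  - by rewrite (ltW y0) (le_trans yx).
  - by rewrite (ltW x0).
  - rewrite distrC ger0_norm ?subr_ge0 // -mulrA -expr2; exact: ler_wpM2l.
move=> le_u; rewrite -[X in _ <= X]mulr_suml in le_u.
(* An integer of absolute value below 1 vanishes. *)
have lt1 : `|(\sum_(i < d.+1) a i * gap f (n + i))%:~R : rat| < 1.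
  rewrite rmorph_sum /=.
  under eq_bigr do rewrite intrM aE -mulrA.
  rewrite -mulr_sumr normrM (gtr0_norm M_gt0).
  apply: le_lt_trans (_ : B * (n%:R * V%:R + X%:R) * x ^+ 2 < 1).
    rewrite /B -!mulrA ler_pM2l //; apply: le_trans le_u _.
    rewrite le_eqVlt; apply/orP; left; apply/eqP; congr (_ * _).
    by rewrite /x; field; rewrite pnatr_eq0 -lt0n.
  rewrite exprVn ltr_pdivrMr ?exprn_gt0 // mul1r.
  apply: le_lt_trans (_ : (Num.bound B)%:R * (n%:R * V%:R + X%:R) < _).
    by rewrite ler_wpM2r ?addr_ge0 ?mulr_ge0 // ltW // archi_boundP.
  by rewrite -natrX -natrM -natrD -natrM ltr_nat.
by apply/eqP; move: lt1; rewrite -intr_norm ltrz1 -normr_le0 -ltzD1 add0r.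
Qed.

Local Open Scope nat_scope.

(** * Equal windows, periodic gaps and progressions *)

(** If all [K] consecutive blocks exceeded slope [c], so would their union. *)
Lemma exists_slow_block (f : nat -> nat) (c L K u : nat) : 0 < K ->
  f (u + K * L) <= f u + c * (K * L) ->
  exists v, [/\ u <= v, v + L <= u + K * L & f (v + L) <= f v + c * L].
Proof.
elim: K u => // -[_ u _|K IHK u _] fu.
  by exists u; rewrite mul1n in fu *.
have [le_f|lt_f] := leqP (f (u + L)) (f u + c * L).
  by exists u; split=> //; rewrite leq_add2l leq_pmull.
have [//||v [le_uv le_v fv]] := IHK (u + L).
  by move: fu; rewrite (mulSn K.+1) addnA mulnDr; lia.
by exists v; split=> //; [apply: leq_trans le_uv; apply: leq_addr | rewrite mulSn addnA].
Qed.

(* Most of the [P] consecutive windows have total variation at most [4 c w],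
   and there are fewer gap patterns with this property than such windows. *)
Lemma exists_equal_windows (f : nat -> nat) (c w u : nat)
    (P := 2 * (4 * c * w) ^ w) :
  {homo f : i j / i <= j} -> 0 < c -> 0 < w ->
  f (u + P * w) <= f u + c * (P * w) ->
  exists n m, [/\ u <= n, n < m, m < u + P * w &
    forall j, j < w -> gap f (n + j) = gap f (m + j)].
Proof.
move=> f_homo c_gt0 w_gt0 fu; pose B := 4 * c * w.
have B_gt0 : 0 < B by rewrite !muln_gt0 c_gt0.
pose var (b : nat) := f (u + b.+1 * w) - f (u + b * w).
pose good := [set b : 'I_P | var b < B].
have sum_var : \sum_(b < P) var b <= c * (P * w).
  rewrite -(big_mkord xpredT var).
  have := @telescope_sumn 0 P (fun b => f (u + b * w)).
  rewrite /var => ->; first by rewrite mul0n addn0 leq_subLR.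
  by move=> i j le_ij; rewrite f_homo // leq_add2l leq_mul2r le_ij orbT.
(* At most a quarter of the windows have variation [B] or more, which leaves at least
   [3 / 2 * B ^ w] good ones. *)
have card_good : B ^ w < #|good|.
  have : #|~: good| * B <= c * (P * w).
    apply: leq_trans sum_var; rewrite -sum_nat_const.
    rewrite [leqRHS](bigID (mem (~: good))) /=.
    apply: leq_trans (leq_addr _ _); apply: leq_sum => b.
    by rewrite !inE -leqNgt.
  have : #|good| + #|~: good| = P by rewrite cardsC card_ord.
  have : 0 < B ^ w by rewrite expn_gt0 B_gt0.
  rewrite /P -/B; set Y := B ^ w; rewrite /B; nia.
pose g i := f i.+1 - f i.
(* All gaps in a good window are below [B], so [inord] loses nothing there. *)
pose pat (b : 'I_P) : {ffun 'I_w -> 'I_B.-1.+1} :=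
  [ffun j : 'I_w => inord (g (u + b * w + j))].
have g_ltB (b : 'I_P) j : b \in good -> j < w -> g (u + b * w + j) < B.-1.+1.
  rewrite inE prednK // => ltB ltj; apply: leq_ltn_trans ltB.
  have : f (u + b * w + j).+1 <= f (u + b.+1 * w) by apply: f_homo; rewrite mulSn; lia.
  have : f (u + b * w) <= f (u + b * w + j) by apply: f_homo; lia.
  rewrite /g /var; lia.
have [b1 [b2 [b1g b2g lt_b pat_eq]]] : exists b1 b2 : 'I_P,
    [/\ b1 \in good, b2 \in good, b1 < b2 & pat b1 = pat b2].
  have : ~~ [forall b1 in good, forall b2 in good, (pat b1 == pat b2) ==> (b1 == b2)].
    apply: contraL card_good => /forall_inP inj_pat; rewrite -leqNgt.
    rewrite -[X in X ^ _]prednK // -{1}(card_ord B.-1.+1) -{1}(card_ord w) -card_ffun.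
    apply: (@leq_card_in _ _ pat) => b1 b2 b1g b2g /eqP e12.
    by move/forall_inP/(_ b2 b2g): (inj_pat b1 b1g); rewrite e12 => /eqP.
  rewrite negb_forall_in => /exists_inP[b1 b1g].
  rewrite negb_forall_in => /exists_inP[b2 b2g].
  rewrite negb_imply => /andP[/eqP e12 neq12].
  move: neq12; rewrite -val_eqE neq_ltn => /orP[lt12|lt21].
    by exists b1, b2.
  by exists b2, b1.
have gapE i : gap f i = Posz (g i) by rewrite /gap /g subzn // f_homo.
exists (u + b1 * w), (u + b2 * w); split.
- exact: leq_addr.
- by rewrite ltn_add2l ltn_mul2r w_gt0.
- by rewrite ltn_add2l ltn_mul2r w_gt0 ltn_ord.
move=> j ltj; rewrite !gapE; congr Posz.
have := congr1 (fun h : {ffun 'I_w -> 'I_B.-1.+1} => val (h (Ordinal ltj))) pat_eq.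
by rewrite !ffunE /= !inordK // g_ltB.
Qed.

(** Since [a t] is nonzero, each value is determined by the [t] preceding ones as long as the
    recurrence holds. *)
Lemma gaps_eq_extend (h : nat -> int) (t n m M : nat) (a : nat -> int) :
  a t != 0%R -> n <= m ->
  (forall i, n <= i < M -> (\sum_(k < t.+1) a k * h (i + k)%N)%R = 0%R) ->
  (forall j, j < t -> h (n + j) = h (m + j)) ->
  forall i, m + i < M + t -> h (n + i) = h (m + i).
Proof.
move=> at0 lenm rec init; elim/ltn_ind => i IHi lt_i.
have [/init //|le_ti] := ltnP i t.
have := rec (m + (i - t)); have := rec (n + (i - t)).
have -> : n <= n + (i - t) < M by lia.
have -> : n <= m + (i - t) < M by lia.
move=> /(_ isT) rec_n /(_ isT) rec_m.
move: (etrans rec_m (esym rec_n)); rewrite !big_ord_recr /=.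
rewrite (eq_bigr (fun k : 'I_t => a k * h (n + (i - t) + k)%N)%R) => [|k _]; last first.
  by rewrite -!addnA IHi //; have := ltn_ord k; lia.
by move/addrI/(mulfI at0) => e; rewrite -!addnA subnK // in e.
Qed.

(** Equal gaps at distance [T] keep [f (i + T) - f i] constant. *)
Lemma arithmetic_progression (f : nat -> nat) (n T M Q : nat) :
  (forall i, n + T + i < M -> gap f (n + i) = gap f (n + T + i)) ->
  f (n + T) = f n + Q ->
  forall j, n + j * T <= M -> f (n + j * T) = f n + j * Q.
Proof.
move=> gap_eq fT.
have shift i : n + T + i <= M -> f (n + T + i) = f (n + i) + Q.
  elim: i => [|i IHi]; first by rewrite !addn0.
  rewrite !addnS => lt_i; have := gap_eq i lt_i; rewrite /gap.
  have := IHi (ltnW lt_i); lia.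
elim=> [|j IHj] le_j; first by rewrite !addn0.
rewrite mulSn addnA shift; last by rewrite -addnA -mulSn.
rewrite IHj; first by rewrite mulSn; lia.
by apply: leq_trans le_j; rewrite leq_add2l leq_mul2r leqnSn orbT.
Qed.

(* Modulo [Q + 1] the difference [Q] is [- 1]. *)
Lemma composite_in_progression (x Q : nat) : 0 < Q -> Q.+1 < x ->
  exists2 j, j <= Q & ~~ prime (x + j * Q).
Proof.
move=> Q_gt0 ltQx; exists (x %% Q.+1); first by rewrite -ltnS ltn_mod.
have dvd : Q.+1 %| x + x %% Q.+1 * Q.
  by rewrite {1}(divn_eq x Q.+1) -addnA -mulnS dvdn_add ?dvdn_mull.
apply/negP => /primeP[_ /(_ _ dvd)] /orP[|] /eqP; lia.
Qed.

(* [L1] is the length of the stretch in which two equal windows of gaps occur.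
   It lies in the first half of a stretch of length [L]; the second half leaves
   room for the progression, whose [Q + 1] terms are at most [L1] indices apart,
   where [Q <= 2 * c * L1]. *)
Lemma no_slow_relation (f : nat -> nat) (d t C c K : nat) (a : nat -> int)
    (w := t.+1) (L1 := 2 * (4 * (2 * c) * w) ^ w * w)
    (L := 2 * ((d + 4) * c * L1 * L1)) (N := K * L) :
  (forall n, f n < f n.+1) -> (forall n, 0 < n -> prime (f n)) ->
  0 < c -> a t != 0%R ->
  (forall n, 0 < n -> C * (n * (f (n + d).+1 - f n) + f (n + d)) < n ^ 2 ->
     (\sum_(k < t.+1) a k * gap f (n + k)%N)%R = 0%R) ->
  f (N + N) <= c * N -> C * c * (L + 1) < N -> L <= N -> False.
Proof.
move=> f_lt f_pr c_gt0 at0 rec fN ltN leLN.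
have f_inc : {mono f : i j / i <= j}.
  by apply: leq_mono; apply: homo_ltn => //; apply: ltn_trans.
have f_homo : {homo f : i j / i <= j} by move=> i j; rewrite f_inc.
have f_ge n : n <= f n by elim: n => // n IHn; apply: leq_ltn_trans IHn (f_lt n).
have L1_gt0 : 0 < L1 by rewrite !muln_gt0 expn_gt0 !muln_gt0 c_gt0.
pose K2 := (d + 4) * c * L1.
have w_gt0 : 0 < w by [].
have lt_tw : t < w by [].
have defL1 : L1 = 2 * (4 * (2 * c) * w) ^ w * w by [].
have defK2 : K2 = (d + 4) * c * L1 by [].
have defL : L = K2 * L1 + K2 * L1 by rewrite /L mul2n addnn.
have defN : N = K * L by [].
clearbody N L K2 L1 w.
have K2_gt0 : 0 < K2 by rewrite defK2 muln_gt0 L1_gt0 muln_gt0 c_gt0 addn4.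
have N_gt0 : 0 < N by apply: leq_ltn_trans ltN.
have K_gt0 : 0 < K by move: N_gt0; rewrite defN muln_gt0 => /andP[].
(* The average slope on [[N, 2N]] is at most [c]. *)
have [v [leNv le_vL fv]] : exists v,
    [/\ N <= v, v + L <= N + N & f (v + L) <= f v + c * L].
  rewrite [X in N + X]defN; apply: exists_slow_block => //.
  by rewrite -defN; apply: leq_trans fN (leq_addl _ _).
(* By monotonicity the first half of the stretch has slope at most [2 * c]. *)
have [u [le_vu le_uL fu]] : exists u, [/\ v <= u, u + L1 <= v + K2 * L1 &
    f (u + L1) <= f u + 2 * c * L1].
  apply: exists_slow_block => //; apply: leq_trans (_ : f (v + L) <= _).
    by rewrite f_inc leq_add2l defL leq_addr.
  by apply: leq_trans fv _; rewrite defL; lia.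
have [n [m [le_un lt_nm lt_mL win]]] : exists n m, [/\ u <= n, n < m, m < u + L1 &
    forall j, j < w -> gap f (n + j) = gap f (m + j)].
  by rewrite defL1; apply: exists_equal_windows; rewrite ?muln_gt0 -?defL1.
have leL : 2 * c * (L1 * L1) + d + 1 <= K2 * L1.
  have : 0 < c * (L1 * L1) by rewrite muln_gt0 c_gt0 muln_gt0 L1_gt0.
  have -> : K2 * L1 = (d + 4) * (c * (L1 * L1)) by rewrite defK2; lia.
  rewrite -mulnA; set Y := c * _; nia.
(* For [i < M] all gaps in the relation at [i] stay inside the stretch. *)
pose M := v + L - d.+1.
have recM i : n <= i < M -> (\sum_(k < t.+1) a k * gap f (i + k)%N)%R = 0%R.
  move=> /andP[le_ni lt_iM]; have leNi : N <= i by lia.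
  apply: rec; first exact: leq_trans leNi.
  have le_gap : f (i + d).+1 - f i <= c * L.
    have : f (i + d).+1 <= f (v + L) by apply: f_homo; rewrite /M in lt_iM; lia.
    have : f v <= f i by apply: f_homo; lia.
    lia.
  have le_f : f (i + d) <= c * i.
    apply: leq_trans (_ : c * N <= _); last by rewrite leq_mul2l leNi orbT.
    by apply: leq_trans fN; apply: f_homo; rewrite /M in lt_iM; lia.
  apply: leq_ltn_trans (_ : C * (i * (c * L) + c * i) < _).
    by rewrite leq_mul2l leq_add ?orbT // leq_mul2l le_gap orbT.
  have -> : C * (i * (c * L) + c * i) = (C * c * (L + 1)) * i by lia.
  by rewrite expnS expn1 ltn_pmul2r ?(leq_trans N_gt0) // (leq_trans ltN).
have gap_eq i : m + i < M -> gap f (n + i) = gap f (m + i).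
  move=> lt_i; apply: (gaps_eq_extend at0 (ltnW lt_nm) recM).
    by move=> j ltj; apply: win; apply: ltn_trans ltj lt_tw.
  exact: leq_trans lt_i (leq_addr _ _).
pose T := m - n; pose Q := f m - f n.
have nT : n + T = m by rewrite subnKC // ltnW.
have Q_gt0 : 0 < Q by rewrite subn_gt0 ltnNge f_inc -ltnNge.
have leT : T <= L1 by lia.
have leQ : Q <= 2 * c * L1.
  have : f m <= f (u + L1) by apply: f_homo; apply: ltnW.
  have : f u <= f n by apply: f_homo.
  lia.
have ltQ : Q.+1 < f n.
  apply: leq_trans (f_ge n); apply: leq_trans (_ : L <= _); last by lia.
  have : 2 * c * L1 <= 2 * c * (L1 * L1) by rewrite leq_mul2l leq_pmull ?orbT.
  by rewrite defL; move: leL leQ; set X := 2 * c * L1; set Y := 2 * c * _; lia.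
have [j le_jQ /negP[]] := composite_in_progression Q_gt0 ltQ.
have leQT : j * T <= 2 * c * (L1 * L1).
  by rewrite mulnA leq_mul // (leq_trans le_jQ).
rewrite -(@arithmetic_progression f n T M Q).
- by apply: f_pr; lia.
- by move=> i; rewrite nT; apply: gap_eq.
- by rewrite nT subnKC // f_homo // ltnW.
by rewrite /M; lia.
Qed.

(** * Choice of parameters for the primes *)

Lemma prime_seq_no_gap_relation (d t C : nat) (a : nat -> int) : a t != 0%R ->
  ~ forall n, 0 < n ->
    C * (n * (prime_seq (n + d).+1 - prime_seq n) + prime_seq (n + d)) < n ^ 2 ->
    (\sum_(k < t.+1) a k * gap prime_seq (n + k)%N)%R = 0%R.
Proof.
move=> at0 rec; pose w := t.+1; pose W := 2 * w * (64 * w) ^ w.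
(* [L] is a constant times [s ^ (w + w + 1)], where [s = r.+1]; the factors [16 * C * s + 1] and
   [2 * s] in [le_K] each cost one more power of [s]. *)
have [r le_r] := exp2_dominates
  ((16 * C + 1) * 2 * (16 * (d + 4) * (W * W))) (w + w + 3).
pose s := r.+1; pose L1 := 2 * (4 * (2 * (8 * s)) * w) ^ w * w.
pose L := 2 * ((d + 4) * (8 * s) * L1 * L1).
have s_gt0 : 0 < s by [].
have defL1 : L1 = W * s ^ w.
  rewrite /L1 (_ : 4 * (2 * (8 * s)) * w = 64 * w * s); last by lia.
  by rewrite expnMn /W; ring.
have L1_gt0 : 0 < L1 by rewrite defL1 !muln_gt0 !expn_gt0.
have L_gt0 : 0 < L.
  by rewrite /L muln_gt0 /= muln_gt0 L1_gt0 muln_gt0 L1_gt0 muln_gt0 addn4.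
have le_K : (16 * C * s + 1) * (2 * s * L) <= 2 ^ r.
  apply: leq_trans le_r; rewrite -/s !expnD /L defL1.
  set Y := s ^ w; rewrite !expnS expn0 muln1.
  rewrite [leqRHS](_ : _ = ((16 * C + 1) * s) *
    (2 * s * (2 * ((d + 4) * (8 * s) * (W * Y) * (W * Y))))); last by ring.
  by rewrite leq_mul2r (mulnDl _ 1 s) leq_add2l mul1n s_gt0 orbT.
(* The largest [K] for which [prime_seq_le] bounds [prime_seq (2 * K * L)] by [2 ^ r.+1]; by
   maximality this is at most [8 * s * (K * L)], hence [c = 8 * s]. *)
pose K := 2 ^ r %/ (2 * s * L).
have sL_gt0 : 0 < 2 * s * L by rewrite muln_gt0 L_gt0.
have leK : 16 * C * s + 1 <= K by rewrite leq_divRL.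
have le_KL : K * (2 * s * L) <= 2 ^ r by apply: leq_trunc_div.
have lt_KL : 2 ^ r < K.+1 * (2 * s * L) by apply: ltn_ceil.
apply: (@no_slow_relation prime_seq d t C (8 * s) K a) => //.
- exact: ltn_prime_seq.
- by case=> // n _; apply: prime_nth_prime.
- rewrite -/w -/L1 -/L; apply: leq_trans (prime_seq_le (r := r) _) _.
    by apply: leq_trans le_KL; rewrite -/s; clearbody K L; lia.
  rewrite expnS; have : 1 * (2 * s * L) <= K * (2 * s * L) by rewrite leq_mul2r; lia.
  by move: lt_KL; rewrite mulSn; clearbody K L; lia.
- rewrite -/w -/L1 -/L; apply: leq_trans (_ : (16 * C * s + 1) * L <= _).
    have : C * s * 1 <= C * s * L by rewrite leq_mul2l L_gt0 orbT.
    by clearbody K L; lia.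
  by rewrite leq_mul2r leK orbT.
- by rewrite -/w -/L1 -/L leq_pmull //; lia.
Qed.

Local Open Scope ring_scope.

Theorem proposition3 (R : realType) :
  ~ holonomic (fun n : nat => (prime_seq n)%:R : R[i]).
Proof.
move=> [d [p [[i0 pi0] pf0]]].
(* [holonomic] pairs [p i] with the shift [d - i], so the indices are reversed. *)
have [||q q_neq0 qf0] :=
    @rational_recurrence _ d (fun i => p (rev_ord i)) prime_seq.
- by exists (rev_ord i0); rewrite rev_ordK.
- move=> n; rewrite -[RHS](pf0 n) [RHS](reindex_inj rev_ord_inj) /=.
  by apply: eq_bigr => i _; rewrite subSS subKn // -ltnS.
have homo : {homo prime_seq : i j / (i <= j)%N}.
  by apply: homo_leq leqnn leq_trans _ => n; apply: ltnW (ltn_prime_seq n).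
have [C [a [[j aj0] rec]]] := gap_relation homo q_neq0 qf0.
(* Cutting at the last nonzero coefficient lets the relation determine later gaps from earlier
   ones. *)
have [t at0 t_max] := @arg_maxnP _ j (fun i => a i != 0) (@nat_of_ord _) aj0.
pose b k := a (inord k).
apply: (@prime_seq_no_gap_relation d t C b) => [|n n_gt0 small].
  by rewrite /b inord_val.
rewrite -[RHS](rec n n_gt0 small).
rewrite (big_ord_widen d.+1 (fun k => b k * gap prime_seq (n + k)%N)) // big_mkcond.
apply: eq_bigr => i _; rewrite /b inord_val; case: ifPn => // le_ti.
suff /eqP-> : a i == 0 by rewrite mul0r.
by apply: contraNT le_ti => ai0; rewrite ltnS; apply: t_max.
Qed.
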